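(* Let $\mathbb F$ be a field of characteristic $0$ and let $C=Cend_{1,x}$ be the associative conformal algebra over $\mathbb F$ described in the context. Then $C$ splits off in each extension with a nilpotent kernel: if $B$ is an associative conformal algebra over $\mathbb F$ and $\sigma:B\to C$ is a surjective homomorphism of conformal algebras such that $\ker\sigma$ is nilpotent, then there exists a conformal subalgebra $C'\subseteq B$ isomorphic to $C$ such that $B=C'\oplus\ker\sigma$ (direct sum of $H$-modules).
   Context: Let $\mathbb F$ be a field of characteristic $0$, $H=\mathbb F[D]$ the polynomial algebra, $\mathbb Z_+$ the non-negative integers. In all formulas below terms with coefficient $0$ are read as $0$, and $\binom{n}{s}=0$ for $s>n$. A conformal algebra is a left $H$-module $A$ with $\mathbb F$-linear maps $\circ_n: A\otimes A\to A$, $n\in\mathbb Z_+$, such that for all $a,b\in A$, $n\in\mathbb Z_+$: (1) $a\circ_n b=0$ for all sufficiently large $n$ (depending on $a,b$); (2) $Da\circ_n b=-n\,a\circ_{n-1}b$; (3) $a\circ_n Db=D(a\circ_n b)+n\,a\circ_{n-1}b$. It is associative if $(a\circ_n b)\circ_m c=\sum_{s\ge0}(-1)^s\binom{n}{s}a\circ_{n-s}(b\circ_{m+s}c)$ for all $a,b,c\in A$, $m,n\in\mathbb Z_+$. Homomorphisms of conformal algebras are $H$-linear maps preserving all operations $\circ_n$; a conformal subalgebra is an $H$-submodule closed under all $\circ_n$. The algebra $Cend_{1,x}$: it is the conformal subalgebra $x\,\mathbb F[D,x]$ of $Cend_1=\mathbb F[D,x]$; it is the free $H$-module with basis $x^k$,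 $k\ge1$, and its operations are determined by (2), (3) and $x^k\circ_n x^l=x^k\,\frac{d^n}{dx^n}(x^l)=n!\binom{l}{n}x^{k+l-n}$ for $k,l\ge1$, $n\in\mathbb Z_+$. A conformal algebra $N$ is nilpotent if there is $r\ge1$ such that every product of $r$ elements of $N$, with any arrangement of brackets and any choice of the operations $\circ_n$, $n\in\mathbb Z_+$, is zero. *)

(* Defs.v *)
From HB Require Import structures.
From mathcomp Require Import all_boot all_algebra.
Set Implicit Arguments.
Unset Strict Implicit.
Unset Printing Implicit Defensive.
Import GRing.Theory.
Local Open Scope ring_scope.

(* [H = F[D]] is [{poly F}], the generator [D] is ['X], and [F] acts on an     *)
(* [H]-module through the constants [c%:P].                                    *)

HB.mixin Record isConformal (F : fieldType) A of GRing.Lmodule {poly F} A := {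
  cprod : nat -> A -> A -> A;
  cprodDl : forall n (a a' b : A),
    cprod n (a + a') b = cprod n a b + cprod n a' b;
  cprodDr : forall n (a b b' : A),
    cprod n a (b + b') = cprod n a b + cprod n a b';
  cprodZl : forall n (c : F) (a b : A),
    cprod n (c%:P *: a) b = c%:P *: cprod n a b;
  cprodZr : forall n (c : F) (a b : A),
    cprod n a (c%:P *: b) = c%:P *: cprod n a b;
  cprod_local : forall a b : A,
    exists N, forall n, (N <= n)%N -> cprod n a b = 0;
  (* For [n = 0] the terms in [n.-1] carry the coefficient 0. *)
  cprod_Dl : forall n (a b : A), cprod n ('X *: a) b = - (cprod n.-1 a b *+ n);
  cprod_Dr : forall n (a b : A),
    cprod n a ('X *: b) = 'X *: cprod n a b + cprod n.-1 a b *+ n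
}.

#[short(type="conformalType")]
HB.structure Definition Conformal (F : fieldType) :=
  {A of GRing.Lmodule {poly F} A & isConformal F A}.

Arguments cprod {F s} n a b.
Notation "a '\o_(' n ) b" := (cprod n a b)
  (at level 40, n at level 50, left associativity,
   format "a  '\o_(' n )  b") : ring_scope.

HB.mixin Record Conformal_isAssoc (F : fieldType) A of Conformal F A := {
  cprodA : forall n m (a b c : A),
    (a \o_(n) b) \o_(m) c =
    \sum_(s < n.+1)
      (-1) ^+ s *: ((a \o_(n - s) (b \o_(m + s) c)) *+ 'C(n, s))
}.

#[short(type="assocConformalType")]
HB.structure Definition AssocConformal (F : fieldType) :=
  {A of Conformal F A & Conformal_isAssoc F A}.

Definition conformal_hom (F : fieldType) (A B : conformalType F)
    (f : {linear A -> B}) : Prop :=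
  forall n (a b : A), f (a \o_(n) b) = f a \o_(n) f b.

Definition conformal_subalgebra (F : fieldType) (B : conformalType F)
    (S : B -> Prop) : Prop :=
  [/\ S 0,
      forall a b, S a -> S b -> S (a + b),
      forall (p : {poly F}) a, S a -> S (p *: a)
    & forall n a b, S a -> S b -> S (a \o_(n) b)].

(* An isomorphism from [C] onto the subalgebra [S] is given by its composite   *)
(* with the inclusion of [S] into [B].                                         *)
Definition isomorphic_onto (F : fieldType) (C B : conformalType F)
    (S : B -> Prop) : Prop :=
  exists f : {linear C -> B},
    [/\ conformal_hom f, injective f
      & forall b, S b <-> exists c, f c = b].

Definition kernel (F : fieldType) (A B : conformalType F)
    (f : {linear A -> B}) : A -> Prop := fun a => f a = 0.

Definition direct_sum_decomposition (F : fieldType) (B : conformalType F)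
    (S T : B -> Prop) : Prop :=
  (forall b, exists s t, [/\ S s, T t & b = s + t]) /\
  (forall b, S b -> T b -> b = 0).

(* [product_of N r z]: [z] is a product of [r] elements of [N], for some       *)
(* arrangement of brackets and some choice of the operations.                  *)
Inductive product_of (F : fieldType) (A : conformalType F) (N : A -> Prop) :
    nat -> A -> Prop :=
| product_one a : N a -> product_of N 1 a
| product_mul r s n a b :
    product_of N r a -> product_of N s b -> product_of N (r + s) (a \o_(n) b).

Definition conformal_nilpotent (F : fieldType) (A : conformalType F)
    (N : A -> Prop) : Prop :=
  exists2 r, (0 < r)%N & forall z, product_of N r z -> z = 0.

(* [Cend_1 = F[D, x]] is [{poly {poly F}}], polynomials in [x] over [H]: ['X%:P] *)
(* is [D] and ['X] is [x].                                                      *)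

Section CendProduct.
Variable F : fieldType.
Implicit Types (p q : {poly F}) (a b c : {poly {poly F}}).

(* The coefficient of [D^i] in [a], which is a polynomial in [x] over [F]. *)
Definition Dcoef i a : {poly {poly F}} :=
  map_poly (fun q : {poly F} => (q`_i)%:P) a.

(* d/dD + d/dx *)
Definition cend_der a : {poly {poly F}} := map_poly (@deriv F) a + a^`().

(* [cprod_Dl], [cprod_Dr] and the values on powers of [x] amount to            *)
(*   sum_n lambda^n / n! (a o_n b) = a(-lambda, x) b(D + lambda, x + lambda),  *)
(* and [b(D + lambda, x + lambda)] is the exponential of [lambda * cend_der]   *)
(* applied to [b].                                                             *)
Definition cend_prod n a b : {poly {poly F}} :=
  \sum_(i < n.+1)
    (-1) ^+ i *: ((Dcoef i a * iter (n - i) cend_der b) *+ n ^_ i).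

Lemma DcoefE i a k : (Dcoef i a)`_k = (a`_k`_i)%:P.
Proof. by rewrite coef_map_id0 // coef0 polyC0. Qed.

Lemma DcoefD i : {morph Dcoef i : a b / a + b}.
Proof. by move=> a b; apply/polyP => k; rewrite coefD !DcoefE !coefD polyCD. Qed.

Lemma DcoefZ i (x : F) a : Dcoef i (x%:P *: a) = x%:P *: Dcoef i a.
Proof. by apply/polyP => k; rewrite DcoefE !coefZ DcoefE coefCM polyCM. Qed.

Lemma DcoefX i a : Dcoef i ('X *: a) = if i is j.+1 then Dcoef j a else 0.
Proof.
apply/polyP => k; rewrite DcoefE coefZ coefXM.
by case: i => [|i] /=; rewrite ?DcoefE ?coef0.
Qed.

Lemma Dcoef_map i p :
  Dcoef i (map_poly polyC p) = if i is 0 then map_poly polyC p else 0.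
Proof.
apply/polyP => k; rewrite DcoefE coef_map /= coefC.
by case: i => [|i] //=; rewrite ?coef_map ?coef0.
Qed.

Lemma cend_derD : {morph cend_der : a b / a + b}.
Proof. by move=> a b; rewrite /cend_der derivD raddfD addrACA. Qed.

Lemma cend_derN : {morph cend_der : a / - a}.
Proof. by move=> a; rewrite /cend_der derivN raddfN opprD. Qed.

Lemma cend_der0 : cend_der 0 = 0.
Proof. by rewrite /cend_der deriv0 raddf0 addr0. Qed.

Lemma cend_derMn a n : cend_der (a *+ n) = cend_der a *+ n.
Proof. by rewrite /cend_der derivMn raddfMn mulrnDl. Qed.

Lemma cend_derM a b : cend_der (a * b) = cend_der a * b + a * cend_der b.
Proof.
rewrite /cend_der derivM.
suff -> : map_poly (@deriv F) (a * b)
          = map_poly (@deriv F) a * b + a * map_poly (@deriv F) b.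
  by rewrite !mulrDl !mulrDr addrACA.
apply/polyP => k; rewrite coef_map /= coefD !coefM -big_split /= (raddf_sum (@deriv F)).
by apply: eq_bigr => i _; rewrite /= derivM !coef_map.
Qed.

Lemma cend_der_map p : cend_der (map_poly polyC p) = map_poly polyC p^`().
Proof.
rewrite /cend_der deriv_map (_ : map_poly _ _ = 0) ?add0r //.
by apply/polyP => k; rewrite !coef_map /= derivC coef0.
Qed.

Lemma cend_derC q : cend_der q%:P = q^`()%:P.
Proof. by rewrite /cend_der derivC map_polyC /= addr0. Qed.

Lemma cend_derZ q a : cend_der (q *: a) = q^`() *: a + q *: cend_der a.
Proof. by rewrite -!mul_polyC cend_derM cend_derC. Qed.

Lemma iter_derD n : {morph iter n cend_der : a b / a + b}.
Proof. by elim: n => // n IHn a b; rewrite !iterS IHn cend_derD. Qed.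

Lemma iter_derZC n (x : F) a :
  iter n cend_der (x%:P *: a) = x%:P *: iter n cend_der a.
Proof. by elim: n => //= n ->; rewrite cend_derZ derivC scale0r add0r. Qed.

Lemma iter_derX n a :
  iter n cend_der ('X *: a)
  = 'X *: iter n cend_der a + iter n.-1 cend_der a *+ n.
Proof.
elim: n => [|n IHn] /=; first by rewrite mulr0n addr0.
rewrite IHn cend_derD cend_derZ derivX scale1r cend_derMn.
rewrite [_ + 'X *: _]addrC -addrA mulrS; congr (_ + (_ + _)).
by case: n {IHn} => [|n] /=; rewrite ?mulr0n.
Qed.

Lemma iter_der_map n p :
  iter n cend_der (map_poly polyC p) = map_poly polyC p^`(n).
Proof. by elim: n => //= n ->; rewrite cend_der_map. Qed.

(* [F[x]] generates [F[D, x]] as an [H]-module. *)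
Lemma cend_ind (P : {poly {poly F}} -> Prop) :
  (forall a b, P a -> P b -> P (a + b)) -> (forall a, P a -> P ('X *: a)) ->
  (forall p, P (map_poly polyC p)) -> forall a, P a.
Proof.
move=> PD PX Pp a; have P0 : P 0 by have := Pp 0; rewrite rmorph0.
rewrite -[a]coefK poly_def; elim/big_ind: _ => // i _.
elim/poly_ind: (a`_i) => [|q c IHq]; first by rewrite scale0r.
rewrite scalerDl mulrC -scalerA; apply: PD; first exact: PX.
suff -> : c%:P *: 'X^i = map_poly polyC (c *: 'X^i) by apply: Pp.
by rewrite linearZ /= map_polyXn.
Qed.

Lemma cend_prodDl n a a' b :
  cend_prod n (a + a') b = cend_prod n a b + cend_prod n a' b.
Proof.
rewrite -big_split /=; apply: eq_bigr => i _.
by rewrite DcoefD mulrDl mulrnDl scalerDr.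
Qed.

Lemma cend_prodDr n a b b' :
  cend_prod n a (b + b') = cend_prod n a b + cend_prod n a b'.
Proof.
rewrite -big_split /=; apply: eq_bigr => i _.
by rewrite iter_derD mulrDr mulrnDl scalerDr.
Qed.

Lemma cend_prodZl n (x : F) a b :
  cend_prod n (x%:P *: a) b = x%:P *: cend_prod n a b.
Proof.
rewrite scaler_sumr; apply: eq_bigr => i _.
by rewrite DcoefZ -scalerAl scalerMnr !scalerA mulrC.
Qed.

Lemma cend_prodZr n (x : F) a b :
  cend_prod n a (x%:P *: b) = x%:P *: cend_prod n a b.
Proof.
rewrite scaler_sumr; apply: eq_bigr => i _.
by rewrite iter_derZC -scalerAr scalerMnr !scalerA mulrC.
Qed.

Lemma cend_prodNl n a b : cend_prod n (- a) b = - cend_prod n a b.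
Proof. by have := cend_prodZl n (-1) a b; rewrite polyCN polyC1 !scaleN1r. Qed.

Lemma cend_prodNr n a b : cend_prod n a (- b) = - cend_prod n a b.
Proof. by have := cend_prodZr n (-1) a b; rewrite polyCN polyC1 !scaleN1r. Qed.

Lemma cend_prodMnl n a b k : cend_prod n (a *+ k) b = cend_prod n a b *+ k.
Proof. by have := cend_prodZl n k%:R a b; rewrite polyC_natr !scaler_nat. Qed.

Lemma cend_prodMnr n a b k : cend_prod n a (b *+ k) = cend_prod n a b *+ k.
Proof. by have := cend_prodZr n k%:R a b; rewrite polyC_natr !scaler_nat. Qed.

Lemma cend_prod_Dl n a b :
  cend_prod n ('X *: a) b = - (cend_prod n.-1 a b *+ n).
Proof.
have h0 k : Dcoef 0 ('X *: a) * iter k cend_der b = 0 by rewrite DcoefX mul0r.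
case: n => [|n]; first by rewrite /cend_prod big_ord1 h0 mul0rn scaler0 oppr0.
rewrite /cend_prod big_ord_recl h0 mul0rn scaler0 add0r.
rewrite -sumrMnl -sumrN; apply: eq_bigr => i _.
rewrite lift0 DcoefX subSS ffactnS exprS mulN1r scaleNr.
by rewrite scalerMnr -mulrnA mulnC.
Qed.

Lemma cend_prod_Dr n a b :
  cend_prod n a ('X *: b) = 'X *: cend_prod n a b + cend_prod n.-1 a b *+ n.
Proof.
rewrite /cend_prod scaler_sumr.
under eq_bigr => i _.
  rewrite iter_derX mulrDr mulrnDl scalerDr -scalerAr scalerMnr scalerA.
  rewrite mulrC -scalerA; over.
rewrite big_split /=; congr (_ + _).
case: n => [|n]; first by rewrite big_ord1 mulr0n mulr0 mul0rn scaler0.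
rewrite big_ord_recr /= subnn mulr0n mulr0 mul0rn scaler0 addr0 -sumrMnl.
apply: eq_bigr => i _; rewrite scalerMnr mulrnAr -!mulrnA.
rewrite mulnC -ffactnSr ffactnS mulnC -subn1 -subnDA.
by rewrite addn1 subSS.
Qed.

Lemma cend_prod_local a b :
  exists N, forall n, (N <= n)%N -> cend_prod n a b = 0.
Proof.
have der_local : exists N, forall n, (N <= n)%N -> iter n cend_der b = 0.
  elim/cend_ind: b => [b b' [N HN] [N' HN']|b [N HN]|p].
  - exists (maxn N N') => n; rewrite geq_max => /andP[hN hN'].
    by rewrite iter_derD HN ?HN' ?addr0.
  - exists N.+1 => -[//|n] hn.
    by rewrite iter_derX !HN //= ?mul0rn ?scaler0 ?addr0 // ltnW.
  - exists (size p) => n hn.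
    by rewrite iter_der_map derivn_poly0 // rmorph0.
elim/cend_ind: a => [a a' [N HN] [N' HN']|a [N HN]|p].
- exists (maxn N N') => n; rewrite geq_max => /andP[hN hN'].
  by rewrite cend_prodDl HN ?HN' ?addr0.
- by exists N.+1 => -[//|n] hn; rewrite cend_prod_Dl HN // mul0rn oppr0.
- have [N HN] := der_local; exists N => n hn; apply: big1 => i _.
  case: i => [[|i] hi] /=; rewrite Dcoef_map ?mul0r ?mul0rn ?scaler0 //.
  by rewrite subn0 HN // mulr0 mul0rn scaler0.
Qed.

Lemma cend_prod_map n p b :
  cend_prod n (map_poly polyC p) b = map_poly polyC p * iter n cend_der b.
Proof.
rewrite /cend_prod big_ord_recl big1 ?addr0 => [|i _].
  by rewrite Dcoef_map subn0 expr0 scale1r ffactn0 mulr1n.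
by rewrite lift0 Dcoef_map mul0r mul0rn scaler0.
Qed.

Lemma cend_prodXn n k l :
  cend_prod n 'X^k 'X^l = 'X^(k + l - n) *+ (n`! * 'C(l, n)).
Proof.
rewrite -!(map_polyXn (polyC : {rmorphism _ -> _})) cend_prod_map iter_der_map.
rewrite derivnXn mulnC bin_ffact rmorphMn /= !map_polyXn mulrnAr -exprD.
have [hn|hn] := leqP n l; first by rewrite addnBA.
by rewrite ffact_small.
Qed.

Lemma cend_leibniz n p c :
  \sum_(s < n.+1) (-1) ^+ s *: (iter (n - s) cend_der
     (map_poly polyC p * iter s cend_der c) *+ 'C(n, s))
  = map_poly polyC p^`(n) * c.
Proof.
pose G i j c := iter i cend_der (map_poly polyC p * iter j cend_der c).
pose S m c := \sum_(s < m.+1) (-1) ^+ s *: (G (m - s)%N s c *+ 'C(m, s)).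
rewrite -/(S n c); elim: n c => [|n IHn] c.
  by rewrite /S big_ord1 expr0 scale1r.
suff -> : S n.+1 c = cend_der (S n c) - S n (cend_der c).
  by rewrite !IHn cend_derM cend_der_map addrK.
have -> : cend_der (S n c)
    = \sum_(s < n.+2) (-1) ^+ s *: (G (n.+1 - s)%N s c *+ 'C(n, s)).
  rewrite [RHS]big_ord_recr /= bin_small // mulr0n scaler0 addr0.
  rewrite (big_morph _ cend_derD cend_der0); apply: eq_bigr => s _.
  rewrite -signr_odd cend_derZ signr_odd -polyC1 -polyCN -polyC_exp derivC.
  by rewrite scale0r add0r cend_derMn subSn // -ltnS.
rewrite /S !(big_ord_recl n.+1) -addrA; congr (_ + _); first by rewrite !bin0.
rewrite -sumrB; apply: eq_bigr => s _.
rewrite !lift0 subSS binS mulrnDr scalerDr; congr (_ + _).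
by rewrite exprS mulN1r scaleNr /G iterSr.
Qed.

Lemma cend_prodA n m a b c :
  cend_prod m (cend_prod n a b) c
  = \sum_(s < n.+1)
      (-1) ^+ s *: (cend_prod (n - s) a (cend_prod (m + s) b c) *+ 'C(n, s)).
Proof.
elim/cend_ind: a n m b => [a a' IH IH'|a IH|p] n m b.
- rewrite cend_prodDl cend_prodDl IH IH' -big_split /=.
  by apply: eq_bigr => s _; rewrite cend_prodDl mulrnDl scalerDr.
- rewrite cend_prod_Dl.
  rewrite cend_prodNl cend_prodMnl IH.
  case: n => [|n].
    by rewrite mulr0n big_ord1 cend_prod_Dl mulr0n oppr0 mul0rn scaler0.
  rewrite [RHS]big_ord_recr /= subnn cend_prod_Dl mulr0n oppr0 mul0rn scaler0 addr0.
  rewrite -sumrMnl -sumrN; apply: eq_bigr => s _.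
  rewrite cend_prod_Dl mulNrn scalerN scalerMnr -!mulrnA.
  rewrite mulnC (mul_bin_down n.+1) -subn1 -subnDA addn1 subSS.
  by [].
elim/cend_ind: b n m => [b b' IH IH'|b IH|q] n m.
- rewrite cend_prodDr cend_prodDl IH IH' -big_split /=.
  by apply: eq_bigr => s _; rewrite cend_prodDl cend_prodDr mulrnDl scalerDr.
- set a := map_poly _ p in IH *.
  rewrite cend_prod_Dr cend_prodDl cend_prod_Dl cend_prodMnl.
  under eq_bigr => s _.
    rewrite cend_prod_Dl cend_prodNr cend_prodMnr mulNrn scalerN.
    rewrite mulrnDr mulrnDl scalerDr opprD; over.
  rewrite big_split /=; congr (_ + _).
    rewrite IH -sumrMnl -sumrN; apply: eq_bigr => s _.
    case: m => [|m]; first by rewrite !mulr0n mul0rn scaler0.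
    by rewrite scalerMnr mulrnAC.
  case: n => [|n].
    by rewrite big_ord1 /= !mulr0n mul0rn scaler0 oppr0.
  rewrite [RHS]big_ord_recl mulr0n mul0rn scaler0 oppr0 add0r IH -sumrMnl.
  apply: eq_bigr => s _; rewrite lift0 subSS addnS exprS mulN1r scaleNr opprK.
  by rewrite scalerMnr -!mulrnA mulnC (mul_bin_diag n.+1).
rewrite !cend_prod_map iter_der_map -rmorphM cend_prod_map rmorphM /=.
rewrite -mulrA -cend_leibniz mulr_sumr; apply: eq_bigr => s _.
by rewrite !cend_prod_map -scalerAr mulrnAr addnC iterD.
Qed.

Lemma cend_prod0 n a b : a`_0 = 0 -> (cend_prod n a b)`_0 = 0.
Proof.
move=> a0; rewrite coef_sum big1 // => i _.
by rewrite coefZ coefMn coefM big_ord1 DcoefE a0 coef0 polyC0 mul0r mul0rn mulr0.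
Qed.

End CendProduct.

Definition xmultiple (F : fieldType) : pred {poly {poly F}} := fun a => a`_0 == 0.

(* [Cend_{1,x} = x F[D, x]]. *)
Record Cend1x (F : fieldType) := Cend1xOf {
  cend1x_val :> {poly {poly F}};
  _ : cend1x_val \in @xmultiple F
}.

Section Cend1xTheory.
Variable F : fieldType.
Implicit Types a b c : Cend1x F.

Lemma xmultipleP (p : {poly {poly F}}) :
  reflect (p`_0 = 0) (p \in @xmultiple F).
Proof. exact: eqP. Qed.

Lemma xmultiple_submod : submod_closed (@xmultiple F).
Proof.
split; first by apply/xmultipleP; rewrite coef0.
move=> p a b /xmultipleP a0 /xmultipleP b0; apply/xmultipleP.
by rewrite coefD coefZ a0 b0 mulr0 addr0.
Qed.

HB.instance Definition _ :=
  GRing.isSubmodClosed.Build {poly F} {poly {poly F}} (@xmultiple F)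
    xmultiple_submod.
HB.instance Definition _ := [isSub for @cend1x_val F].
HB.instance Definition _ := [Choice of Cend1x F by <:].
HB.instance Definition _ := [SubChoice_isSubLmodule of Cend1x F by <:].

Fact cend1x_prod_subproof n a b : cend_prod n a b \in @xmultiple F.
Proof. by apply/xmultipleP/cend_prod0/xmultipleP; case: a. Qed.

Definition cend1x_prod n a b : Cend1x F := Cend1xOf (cend1x_prod_subproof n a b).

Fact cend1x_prodDl n a a' b :
  cend1x_prod n (a + a') b = cend1x_prod n a b + cend1x_prod n a' b.
Proof. by apply: val_inj; apply: cend_prodDl. Qed.

Fact cend1x_prodDr n a b b' :
  cend1x_prod n a (b + b') = cend1x_prod n a b + cend1x_prod n a b'.
Proof. by apply: val_inj; apply: cend_prodDr. Qed.

Fact cend1x_prodZl n (x : F) a b :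
  cend1x_prod n (x%:P *: a) b = x%:P *: cend1x_prod n a b.
Proof. by apply: val_inj; apply: cend_prodZl. Qed.

Fact cend1x_prodZr n (x : F) a b :
  cend1x_prod n a (x%:P *: b) = x%:P *: cend1x_prod n a b.
Proof. by apply: val_inj; apply: cend_prodZr. Qed.

Fact cend1x_prod_local a b :
  exists N, forall n, (N <= n)%N -> cend1x_prod n a b = 0.
Proof.
have [N HN] := cend_prod_local a b; exists N => n hn.
by apply: val_inj; rewrite /= HN.
Qed.

Fact cend1x_prod_Dl n a b :
  cend1x_prod n ('X *: a) b = - (cend1x_prod n.-1 a b *+ n).
Proof.
by apply: val_inj; rewrite raddfN raddfMn; apply: cend_prod_Dl.
Qed.

Fact cend1x_prod_Dr n a b :
  cend1x_prod n a ('X *: b) = 'X *: cend1x_prod n a b + cend1x_prod n.-1 a b *+ n.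
Proof.
by apply: val_inj; rewrite raddfD raddfMn; apply: cend_prod_Dr.
Qed.

HB.instance Definition _ := @isConformal.Build F (Cend1x F) cend1x_prod
  cend1x_prodDl cend1x_prodDr cend1x_prodZl cend1x_prodZr cend1x_prod_local
  cend1x_prod_Dl cend1x_prod_Dr.

Fact cend1x_prodA n m a b c :
  (a \o_(n) b) \o_(m) c =
  \sum_(s < n.+1) (-1) ^+ s *: ((a \o_(n - s) (b \o_(m + s) c)) *+ 'C(n, s)).
Proof.
apply: val_inj; rewrite raddf_sum [LHS]cend_prodA; apply: eq_bigr => s _.
by congr (_ *: _); rewrite raddfMn.
Qed.
HB.instance Definition _ := Conformal_isAssoc.Build F (Cend1x F) cend1x_prodA.

Fact xmultipleXn k : 'X^(k.+1) \in @xmultiple F.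
Proof. by apply/xmultipleP; rewrite coefXn. Qed.

Definition cend1x_pow k : Cend1x F := Cend1xOf (xmultipleXn k).

Lemma cend1x_prod_pow n k l :
  cend1x_val (cend1x_pow k \o_(n) cend1x_pow l)
  = 'X^(k.+1 + l.+1 - n) *+ (n`! * 'C(l.+1, n)).
Proof. exact: cend_prodXn. Qed.

End Cend1xTheory.

(* Main.v *)
Require Import Defs.
From HB Require Import structures.
From mathcomp Require Import all_boot all_algebra.
From Stdlib Require Import Setoid Morphisms.
Set Implicit Arguments.
Unset Strict Implicit.
Unset Printing Implicit Defensive.
Import GRing.Theory.
Local Open Scope ring_scope.

(** [Cend_{1,x}] is presented by the single generator [e = x] with the
    relations [e \o_(1) e = e] and [e \o_(n) e = 0] for [n >= 2]: they force
    the elements [e \o_(0) (... (e \o_(0) e))] of any associative conformal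
    algebra to multiply like the powers of [x] ([cprod_pow], [pow_map_hom]).
    To split [sigma], it therefore suffices to lift [x] to some [e] in [B]
    that satisfies these relations exactly.

    An arbitrary lift of [x] satisfies them up to the kernel, and it is
    corrected along the tower of ideals that starts at the kernel and
    continues by [J |-> span of J \o J], which ends at 0 by nilpotency
    ([nilpotent_tower]).  One step ([improve_approx]) has errors
    [r_1 = e \o_(1) e - e] and [r_n = e \o_(n) e], [n >= 2], in an ideal [J],
    and must push them into an ideal [I] with [J \o J <= I <= J] by adding to
    [e] an element [m] of [J].  Modulo [I], the ideal [J] is a bimodule over
    [Cend_{1,x}], and this amounts to the vanishing of a second cohomology
    class.

    Write [e_n] for left multiplication by [e] under [\o_(n)].  Modulo [I],
    [e_n] acts on [J] like [x d^n], with [d] satisfying [d x - x d = 1]; so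
    [e_1] is an Euler operator, the product of [e_1 - i] over [i < k] is
    [x^k d^k], and locality makes it vanish on each given vector for large
    [k] ([euler_prod_nil]).  Thus [e_1] is locally diagonalizable with
    eigenvalues in the natural numbers, and [e_0] raises weights by 1.  On the
    other side, [T = (- \o_(1) e)] is idempotent, and its image, the space of
    right fixed elements, is stable under all [e_n].  Adding [m] changes [r_1]
    by [(e_1 - 1 + T) m].  Associativity of the triples
    [e \o_(a) (e \o_(1) e)], [a = 1, 2], shows that
    - modulo right fixed elements [r_1] has no component of weight 1, so
      [e_1 - 1] can be inverted there and [r_1] can be made right fixed
      ([fix_defect1]);
    - a right fixed [r_1] has no component of weight 0, and
      [e_1 - 1 + T = e_1] on right fixed elements, so [r_1] can be killed
      ([kill_defect1]).
    Once [r_1 = 0], the same identities for all [a >= 2] and a downward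
    induction on [a] show that every [r_a] vanishes ([defects_vanish]). *)

(** * Products and the second form of associativity *)

Section Products.
Variables (F : fieldType) (B : assocConformalType F).
Implicit Types (a b c : B) (n m k : nat).

Lemma cprodBr n a b c : a \o_(n) (b - c) = a \o_(n) b - a \o_(n) c.
Proof.
by rewrite cprodDr -scaleN1r -polyC1 -polyCN cprodZr polyCN polyC1 scaleN1r.
Qed.

Lemma cprodBl n a b c : (a - b) \o_(n) c = a \o_(n) c - b \o_(n) c.
Proof.
by rewrite cprodDl -scaleN1r -polyC1 -polyCN cprodZl polyCN polyC1 scaleN1r.
Qed.

Definition lmul n a b : B := a \o_(n) b.
Definition rmul n b a : B := a \o_(n) b.

HB.instance Definition _ n a :=
  GRing.isZmodMorphism.Build B B (lmul n a) (cprodBr n a).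
HB.instance Definition _ n b :=
  GRing.isZmodMorphism.Build B B (rmul n b) (fun x y => cprodBl n x y b).

Lemma cprod0r n a : a \o_(n) 0 = 0.
Proof. exact: (raddf0 (lmul n a)). Qed.

Lemma cprodMnr n a b k : a \o_(n) (b *+ k) = (a \o_(n) b) *+ k.
Proof. exact: (raddfMn (lmul n a)). Qed.

Lemma cprod0l n b : 0 \o_(n) b = 0.
Proof. exact: (raddf0 (rmul n b)). Qed.

Section BinomialInversion.
Variables (V : zmodType) (G : nat -> nat -> V).

(** The [k]-th iterate of the difference of the two shifts, which raise
    respectively the first and the second argument of [G]; associativity
    expresses [(a \o_(n) b) \o_(m) c] in this form. *)
Definition diff_iter k i j :=
  \sum_(s < k.+1) (G (i + (k - s))%N (j + s)%N *+ 'C(k, s)) *~ (-1) ^+ s.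

Lemma diff_iterS k i j :
  diff_iter k.+1 i j + diff_iter k i j.+1 = diff_iter k i.+1 j.
Proof.
have -> : diff_iter k i.+1 j =
    \sum_(s < k.+2) (G (i + (k.+1 - s))%N (j + s)%N *+ 'C(k, s)) *~ (-1) ^+ s.
  rewrite big_ord_recr /= bin_small // mulr0n mul0rz addr0.
  by apply: eq_bigr => s _; rewrite addSnnS subSn // -ltnS.
rewrite /diff_iter !(big_ord_recl k.+1) -addrA !bin0; congr (_ + _).
rewrite -big_split; apply: eq_bigr => s _.
rewrite !lift0 subSS binS mulrnDr mulrzDl addSnnS exprS mulN1r.
by rewrite !mulrNz /= addrNK.
Qed.

(** With [P] and [Q] the two shifts, this is [((P - Q) + Q)^n = P^n]. *)
Lemma binomial_inversion n i j :
  \sum_(t < n.+1) diff_iter (n - t) i (j + t) *+ 'C(n, t) = G (i + n)%N j.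
Proof.
elim: n i j => [|n IHn] i j.
  by rewrite big_ord1 /diff_iter big_ord1 !addn0.
rewrite -addSnnS -IHn big_ord_recl bin0.
under eq_bigr => t _ do rewrite lift0 subSS binS mulrnDr.
rewrite big_split addrA /=.
have -> : diff_iter (n.+1 - 0) i (j + 0) *+ 1
          + \sum_(t < n.+1) diff_iter (n - t) i (j + t.+1) *+ 'C(n, t.+1)
        = \sum_(t < n.+1) diff_iter (n.+1 - t) i (j + t) *+ 'C(n, t).
  rewrite [RHS]big_ord_recl bin0; congr (_ + _).
  by rewrite big_ord_recr /= bin_small // mulr0n addr0.
rewrite -big_split; apply: eq_bigr => t _; rewrite /= -mulrnDl.
have le_tn : (t <= n)%N by rewrite -ltnS.
by rewrite (subSn le_tn) addnS diff_iterS.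
Qed.

End BinomialInversion.

(** Inverting the binomial sum in the axiom of associativity. *)
Lemma cprodAr n m a b c :
  a \o_(n) (b \o_(m) c)
  = \sum_(t < n.+1) ((a \o_(n - t) b) \o_(m + t) c) *+ 'C(n, t).
Proof.
rewrite -(binomial_inversion (fun i j => a \o_(i) (b \o_(j) c)) n 0%N m).
apply: eq_bigr => t _; rewrite cprodA; congr (_ *+ _).
apply: eq_bigr => s _; rewrite add0n -addnA.
by rewrite -signr_odd -(signr_odd {poly F}); case: (odd s);
  rewrite ?expr1 ?expr0 ?scaleN1r ?mulrN1z ?mulr1z ?scale1r.
Qed.

Lemma cprod0A m a b c : (a \o_(0) b) \o_(m) c = a \o_(0) (b \o_(m) c).
Proof. by rewrite cprodA big_ord1 scale1r bin0 mulr1n addn0. Qed.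

End Products.

(** * Congruences modulo an ideal *)

Section Subspaces.
Variables (F : fieldType) (B : assocConformalType F).
Implicit Types (J : B -> Prop) (a b c : B).

(** [x%:P *: a] is the action of the field, so these are the subspaces over
    [F]. *)
Definition subspace J :=
  [/\ J 0, forall a b, J a -> J b -> J (a + b)
    & forall (x : F) a, J a -> J (x%:P *: a)].

Definition ideal J :=
  [/\ subspace J, forall n a b, J b -> J (a \o_(n) b)
    & forall n a b, J a -> J (a \o_(n) b)].

Section Closure.
Variables (J : B -> Prop) (sJ : subspace J).

Lemma subspace0 : J 0. Proof. by case: sJ. Qed.

Lemma subspaceD a b : J a -> J b -> J (a + b).
Proof. by case: sJ => _ + _; apply. Qed.

Lemma subspaceZ (x : F) a : J a -> J (x%:P *: a).
Proof. by case: sJ => _ _; apply. Qed.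

Lemma subspaceN a : J a -> J (- a).
Proof. by move/(subspaceZ (-1)); rewrite polyCN polyC1 scaleN1r. Qed.

Lemma subspaceB a b : J a -> J b -> J (a - b).
Proof. by move=> Ja /subspaceN; apply: subspaceD. Qed.

Lemma subspaceMn a k : J a -> J (a *+ k).
Proof. by move/(subspaceZ k%:R); rewrite polyC_natr scaler_nat. Qed.

Lemma subspace_divn (charF0 : [pchar F] =i pred0) a n : J (a *+ n.+1) -> J a.
Proof.
move=> /(subspaceZ (n.+1%:R)^-1).
rewrite -scaler_nat -polyC_natr scalerA -polyCM mulVf ?polyC1 ?scale1r //.
by rewrite (pcharf0P F).1.
Qed.

Lemma subspace_sum k (G : 'I_k -> B) :
  (forall i, J (G i)) -> J (\sum_i G i).
Proof.
by move=> JG; apply: big_ind => //; [apply: subspace0|apply: subspaceD].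
Qed.

End Closure.

(** A setoid congruence stands for equality in the quotient by [J]. *)
Definition eqmod J a b := J (a - b).

Section Congruence.
Variables (J : B -> Prop) (idJ : ideal J).

Let sJ : subspace J. Proof. by case: idJ. Qed.

Lemma eqmod_equiv : Equivalence (eqmod J).
Proof.
split=> [a|a b Jab|a b c Jab Jbc]; rewrite /eqmod.
- by rewrite subrr; apply: subspace0.
- by rewrite -opprB; apply: subspaceN.
- by rewrite -[a](subrK b) -addrA; apply: subspaceD.
Qed.

Lemma eqmodD :
  Proper (eqmod J ==> eqmod J ==> eqmod J) (@GRing.add B).
Proof.
move=> a a' Ja b b' Jb; rewrite /eqmod opprD addrACA; exact: subspaceD.
Qed.

Lemma eqmodN : Proper (eqmod J ==> eqmod J) (@GRing.opp B).
Proof. by move=> a a' Ja; rewrite /eqmod -opprD; apply: subspaceN. Qed.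

Lemma eqmodMn :
  Proper (eqmod J ==> eq ==> eqmod J) (@GRing.natmul B).
Proof. by move=> a a' Ja k _ <-; rewrite /eqmod -mulrnBl; apply: subspaceMn. Qed.

Lemma eqmodM n :
  Proper (eqmod J ==> eqmod J ==> eqmod J) (@cprod F B n).
Proof.
case: idJ => _ Jl Jr a a' Ja b b' Jb; rewrite /eqmod.
have -> : a \o_(n) b - a' \o_(n) b' = (a - a') \o_(n) b + a' \o_(n) (b - b').
  by rewrite cprodBl cprodBr addrA subrK.
by apply: (subspaceD sJ); [apply: Jr | apply: Jl].
Qed.

Lemma eqmod0 a : J a -> eqmod J a 0.
Proof. by rewrite /eqmod subr0. Qed.

End Congruence.

End Subspaces.

(** * Products of factors of the Euler operator *)

Lemma iota_succ m k : iota m.+1 k = map S (iota m k).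
Proof. exact: (iotaDl 1). Qed.

Section EulerFactors.
Variables (F : fieldType) (B : assocConformalType F) (e : B).
Implicit Types (v w : B) (s : seq nat).

Definition euler_shift c v : B := e \o_(1) v - v *+ c.
Definition euler_prod s v := foldl (fun w c => euler_shift c w) v s.

Lemma euler_shiftB c : zmod_morphism (euler_shift c).
Proof.
move=> v w; rewrite /euler_shift cprodBr mulrnBl !opprB !addrA.
by rewrite [LHS](ACl (1*4*3*2)).
Qed.

HB.instance Definition _ c :=
  GRing.isZmodMorphism.Build B B (euler_shift c) (euler_shiftB c).

Lemma euler_shiftZ c (x : F) v :
  euler_shift c (x%:P *: v) = x%:P *: euler_shift c v.
Proof. by rewrite /euler_shift cprodZr scalerBr scalerMnr. Qed.

Lemma euler_prodB s : zmod_morphism (euler_prod s).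
Proof. by elim: s => //= c s IHs v w; rewrite /= raddfB -IHs. Qed.

HB.instance Definition _ s :=
  GRing.isZmodMorphism.Build B B (euler_prod s) (euler_prodB s).

Lemma euler_prodD s : {morph euler_prod s : v w / v + w}.
Proof. exact: raddfD. Qed.

Lemma euler_shiftC c d v :
  euler_shift c (euler_shift d v) = euler_shift d (euler_shift c v).
Proof.
rewrite /euler_shift !cprodBr !cprodMnr !mulrnBl !opprB !addrA -!mulrnA mulnC.
by rewrite [LHS](ACl (1*4*3*2)).
Qed.

Lemma euler_prod_shift s c v :
  euler_prod s (euler_shift c v) = euler_shift c (euler_prod s v).
Proof. by elim: s v => //= d s IHs v; rewrite euler_shiftC IHs. Qed.

Lemma euler_prod_e1 s v :
  euler_prod s (e \o_(1) v) = e \o_(1) euler_prod s v.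
Proof. by have := euler_prod_shift s 0 v; rewrite /euler_shift !mulr0n !subr0. Qed.

Lemma euler_prod_rcons s c v :
  euler_prod (rcons s c) v = euler_shift c (euler_prod s v).
Proof. by rewrite /euler_prod -cats1 foldl_cat. Qed.

Section Stable.
Variables (Q : B -> Prop) (sQ : subspace Q).
Hypothesis Q_e1 : forall v, Q v -> Q (e \o_(1) v).

Lemma euler_shift_stable c v : Q v -> Q (euler_shift c v).
Proof.
by move=> Qv; apply: (subspaceB sQ); [apply: Q_e1 | apply: subspaceMn].
Qed.

Lemma euler_prod_stable s v : Q v -> Q (euler_prod s v).
Proof. by elim: s v => //= c s IHs v Qv; apply/IHs/euler_shift_stable. Qed.

(** Division with remainder: a polynomial [p] in [e_1] is the invertible
    constant [p(d)] modulo [e_1 - d], when [d] is not among its roots.  Hence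
    a vector killed by [p (e_1)] lies in the image of [e_1 - d], with a
    preimage in any [e_1]-stable subspace containing the vector. *)
Lemma euler_prod_remainder (charF0 : [pchar F] =i pred0) s d v :
    d \notin s -> Q v ->
  exists x : F, exists w, [/\ x != 0, Q w
    & euler_prod s v = x%:P *: v + euler_shift d w].
Proof.
elim: s v => [|c s IHs] v /=.
  move=> _ Qv; exists 1, 0; rewrite oner_neq0 raddf0 addr0 scale1r.
  by split=> //; apply: subspace0.
rewrite inE negb_or => /andP[neq_dc s'd] Qv.
have [x [w [nz_x Qw ->]]] := IHs _ s'd (euler_shift_stable c Qv).
exists (x * (d%:R - c%:R)), (w + x%:P *: v); split.
- have nat_eq0 n : (n%:R == 0 :> F) = (n == 0%N) by move: n; apply/pcharf0P.
  rewrite mulf_neq0 // subr_eq0; have [lt_dc|lt_cd|eq_dc] := ltngtP d c.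
  + by rewrite eq_sym -subr_eq0 -natrB ?(ltnW lt_dc) // nat_eq0 subn_eq0 -ltnNge.
  + by rewrite -subr_eq0 -natrB ?(ltnW lt_cd) // nat_eq0 subn_eq0 -ltnNge.
  + by rewrite eq_dc eqxx in neq_dc.
- by apply: (subspaceD sQ) => //; apply: subspaceZ.
have -> : euler_shift c v = (d%:R - c%:R)%:P *: v + euler_shift d v.
  rewrite /euler_shift polyCB !polyC_natr scalerBl !scaler_nat.
  by rewrite [RHS]addrC addrA subrK.
rewrite scalerDr scalerA -polyCM -addrA -euler_shiftZ.
by rewrite raddfD /= [euler_shift d w + _]addrC.
Qed.

End Stable.
End EulerFactors.

(** * Errors in the defining relations *)

(** Meaningful for [n > 0] only: [e \o_(0) e] is unconstrained.  The
    definition is locked so that rewriting with additive identities does not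
    look inside it. *)
HB.lock Definition defect (F : fieldType) (B : assocConformalType F) (e : B) n :=
  e \o_(n) e - e *+ (n == 1).

Definition approx (F : fieldType) (B : assocConformalType F) (Q : B -> Prop)
  (e : B) := forall n, (0 < n)%N -> Q (defect e n).

Section Cocycle.
Variables (F : fieldType) (B : assocConformalType F).
Implicit Types e m : B.

Lemma cprod_self e n : e \o_(n) e = e *+ (n == 1) + defect e n.
Proof. by rewrite !defect.unlock addrC subrK. Qed.

Lemma defectD e m n :
  defect (e + m) n
  = defect e n + (e \o_(n) m + m \o_(n) e - m *+ (n == 1)) + m \o_(n) m.
Proof.
rewrite !defect.unlock cprodDl !cprodDr mulrnDl opprD !addrA.
by rewrite [LHS](ACl (1*5*2*3*6*4)).
Qed.

(** Both cocycle identities expand [e \o_(a) (e \o_(1) e)] by [cprodAr]; here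
    [a = 1]. *)
Lemma defect_cocycle1 e :
  e \o_(1) defect e 1 = defect e 1 \o_(1) e + e \o_(0) defect e 2.
Proof.
have := cprodAr 1 1 e e e.
rewrite big_ord_recl big_ord1 lift0 !binn bin0 !mulr1n.
rewrite subnn subn0 cprod0A [(1 + ord0)%N]addn0 !(cprod_self e 1).
rewrite (cprod_self e (1 + 1)) mulr0n add0r mulr1n.
rewrite cprodDr cprodDl (cprod_self e 1) mulr1n => eq_e.
by apply: (addrI (e + defect e 1)); rewrite eq_e -!addrA.
Qed.

(** The case [a = k + 2].  The last two terms of the expansion are separated
    since they involve [e \o_(1) e] and [e \o_(0) e]. *)
Lemma defect_cocycle e k :
  e \o_(k.+2) defect e 1 + defect e k.+2
  = \sum_(t < k.+1) (defect e (k.+2 - t) \o_(1 + t) e) *+ 'C(k.+2, t)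
    + (defect e k.+2 + defect e 1 \o_(k.+2) e) *+ k.+2
    + e \o_(0) defect e k.+3.
Proof.
have eq_k := cprodAr k.+2 1 e e e; rewrite 2!big_ord_recr /= in eq_k.
rewrite binn mulr1n subnn binSn subSnn cprod0A !add1n in eq_k.
rewrite (cprod_self e 1) mulr1n cprodDr cprodDl in eq_k.
rewrite (cprod_self e k.+2) (cprod_self e k.+3) mulr0n !add0r in eq_k.
rewrite addrC eq_k; congr (_ + _ + _); apply: eq_bigr => t _.
rewrite cprod_self (_ : _ == _ = false) ?mulr0n ?add0r //.
by rewrite gtn_eqF // ltn_subRL addn1 !ltnS -ltnS.
Qed.

Lemma defect_mulrn e k :
  defect e k.+2 *+ k.+1
  = e \o_(k.+2) defect e 1
    - (\sum_(t < k.+1) (defect e (k.+2 - t) \o_(1 + t) e) *+ 'C(k.+2, t)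
       + (defect e 1 \o_(k.+2) e) *+ k.+2 + e \o_(0) defect e k.+3).
Proof.
have := defect_cocycle e k; rewrite mulrnDl [defect e k.+2 *+ k.+2]mulrS.
move: (\sum_(t < _) _) (defect e 1 \o_(k.+2) e *+ _) (defect e k.+2 *+ _).
move=> S P Q eq_k; apply/eqP.
rewrite eq_sym subr_eq -(inj_eq (addIr (defect e k.+2))) eq_k; apply/eqP.
by rewrite !addrA [LHS](ACl (3*1*4*5*2)).
Qed.

End Cocycle.

(** * Correcting a lift modulo the next ideal *)

Section LiftStep.
Variables (F : fieldType) (charF0 : [pchar F] =i pred0).
Variables (B : assocConformalType F) (J I : B -> Prop).
Hypotheses (idJ : ideal J) (idI : ideal I).
Hypothesis IJ : forall a, I a -> J a.
Hypothesis JJ : forall n a b, J a -> J b -> I (a \o_(n) b).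

Local Notation "a ≡ b" := (eqmod I a b) (at level 70).

Let sJ : subspace J. Proof. by case: idJ. Qed.
Let sI : subspace I. Proof. by case: idI. Qed.
Let Jl n a b : J b -> J (a \o_(n) b). Proof. by case: idJ => _ + _; apply. Qed.
Let Jr n a b : J a -> J (a \o_(n) b). Proof. by case: idJ => _ _; apply. Qed.
Let Il n a b : I b -> I (a \o_(n) b). Proof. by case: idI => _ + _; apply. Qed.
Local Instance eqmodI : Equivalence (eqmod I) := eqmod_equiv idI.
Local Instance eqmodDI : Proper _ _ := eqmodD idI.
Local Instance eqmodNI : Proper _ _ := eqmodN idI.
Local Instance eqmodMnI : Proper _ _ := eqmodMn idI.
Local Instance eqmodMI n : Proper _ _ := eqmodM idI n.

Let eqmodxx a : a ≡ a. Proof. reflexivity. Qed.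
#[local] Hint Resolve eqmodxx : core.

Section FixedLift.
Variables (e : B) (e_approx : approx J e).

Local Instance euler_shift_eqmod c :
  Proper (eqmod I ==> eqmod I) (euler_shift e c).
Proof.
move=> a b Iab; rewrite /eqmod -raddfB.
by apply: euler_shift_stable => //; apply: Il.
Qed.

Local Instance euler_prod_eqmod s :
  Proper (eqmod I ==> eqmod I) (euler_prod e s).
Proof.
move=> a b Iab; rewrite /eqmod -raddfB.
by apply: euler_prod_stable => //; apply: Il.
Qed.

(** The relation [x d x d^n = x x d^(n+1) + x d^n] of differential operators
    on the bimodule [J / I]. *)
Lemma euler_relation n v : J v ->
  e \o_(1) (e \o_(n) v) ≡ e \o_(0) (e \o_(n.+1) v) + e \o_(n) v.
Proof.
move=> Jv; have := cprodA 1 n e e v.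
rewrite big_ord_recl big_ord1 /= !subn0 subnn addn0 expr0 expr1 !mulr1n.
rewrite scale1r scaleN1r cprod_self mulr1n cprodDl addn1 => /eqP.
rewrite eq_sym subr_eq => /eqP->.
rewrite [X in eqmod I (_ + X + _) _]eqmod0 ?addr0 1?addrC; last first.
  by apply: JJ => //; apply: e_approx.
reflexivity.
Qed.

Lemma euler_shift_e0 c v : J v ->
  euler_shift e c.+1 (e \o_(0) v) ≡ e \o_(0) euler_shift e c v.
Proof.
move=> Jv; rewrite /euler_shift euler_relation //.
by rewrite cprodBr cprodMnr mulrS opprD addrA addrK.
Qed.

Lemma euler_prod_e0 s v : J v ->
  euler_prod e (map S s) (e \o_(0) v) ≡ e \o_(0) euler_prod e s v.
Proof.
elim: s v => [//|c s IHs] v Jv /=.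
rewrite euler_shift_e0 //; apply: IHs.
by apply: euler_shift_stable => // w; apply: Jl.
Qed.

(** The identity [(x d) (x d - 1) ... (x d - k) = x^(k+1) d^(k+1)], where
    [x^(k+1) d^(k+1)] is [e_0] iterated [k] times on [e_(k+1)]. *)
Lemma euler_prod_iota k v : J v ->
  euler_prod e (iota 0 k.+1) v ≡ iter k (cprod 0 e) (e \o_(k.+1) v).
Proof.
move=> Jv; elim: k => [|k IHk]; first by rewrite /= /euler_shift mulr0n subr0.
rewrite -[k.+2]addn1 iotaD cats1 euler_prod_rcons IHk add0n addn1 iterSr.
have shift_iter j w : J w ->
    euler_shift e j.+1 (iter j (cprod 0 e) w)
    ≡ iter j (cprod 0 e) (euler_shift e 1 w).
  elim: j w => [//|j IHj] w Jw.
  rewrite [in X in eqmod I X _]iterS euler_shift_e0; last first.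
    by elim: (j) => //= i; apply: Jl.
  by rewrite IHj.
have iter_eqmod j a b : a ≡ b -> iter j (cprod 0 e) a ≡ iter j (cprod 0 e) b.
  by move=> ab; elim: j => //= j ->.
rewrite shift_iter; last exact: Jl.
apply: iter_eqmod; rewrite /euler_shift euler_relation // addrK.
reflexivity.
Qed.

Lemma euler_prod_nil v : J v ->
  exists K, forall k, (K <= k)%N -> euler_prod e (iota 0 k) v ≡ 0.
Proof.
move=> Jv; have [K HK] := cprod_local e v; exists K.+1 => -[//|k] hk.
rewrite euler_prod_iota // HK 1?ltnW //.
by elim: k {hk} => [|k IHk] /=; [|rewrite IHk cprod0r].
Qed.

(** The image of [T], as [T] is idempotent on [J / I] by [right_mul]. *)
Definition right_fixed v := J v /\ v \o_(1) e ≡ v.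

(** Only the terms with [e \o_(1) e], which is [e] up to [J], survive in the
    expansion by associativity; the others lie in [J \o J]. *)
Lemma right_mul n k v : J v -> (0 < k)%N ->
  (v \o_(n) e) \o_(k) e ≡ (v \o_(n) e) *+ (k == 1).
Proof.
move=> Jv k_gt0; rewrite cprodA big_ord_recl expr0 scale1r bin0 mulr1n subn0.
rewrite addn0 cprod_self cprodDr cprodMnr.
rewrite [X in eqmod I (_ + X + _) _]eqmod0 ?addr0; last first.
  by apply: JJ => //; apply: e_approx.
rewrite [X in eqmod I (_ + X) _]eqmod0 ?addr0 //.
apply: (subspace_sum sI) => s; rewrite lift0 -signr_odd.
have -> : (-1) ^+ odd s.+1 = ((-1) ^+ odd s.+1)%:P :> {poly F}.
  by rewrite rmorphXn /= polyCN polyC1.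
apply: (subspaceZ sI); apply: (subspaceMn sI).
rewrite cprod_self addnS (_ : _ == _ = false); last first.
  by rewrite gtn_eqF // ltnS addn_gt0 k_gt0.
by rewrite mulr0n add0r; apply: JJ => //; apply: e_approx.
Qed.

Lemma right_fixed_r n v : J v -> right_fixed (v \o_(n) e).
Proof. by move=> Jv; split; [apply: Jr | rewrite right_mul]. Qed.

Lemma right_fixed_kill k v : (1 < k)%N -> right_fixed v -> v \o_(k) e ≡ 0.
Proof.
move=> k_gt1 [Jv vfix]; rewrite -vfix right_mul ?(ltnW k_gt1) //.
by rewrite gtn_eqF // mulr0n.
Qed.

Lemma right_fixed_subspace : subspace right_fixed.
Proof.
split=> [|a b [Ja afix] [Jb bfix]|x a [Ja afix]].
- by split; [apply: subspace0 | rewrite cprod0l].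
- split; first exact: (subspaceD sJ).
  by rewrite cprodDl afix bfix.
split; first exact: (subspaceZ sJ).
by rewrite cprodZl /eqmod -scalerBr; apply: (subspaceZ sI).
Qed.

Lemma right_fixed_eqmod u v : u ≡ v -> right_fixed v -> right_fixed u.
Proof.
move=> uv [Jv vfix]; split; last by rewrite uv vfix.
by rewrite -[u](subrK v); apply: (subspaceD sJ) => //; apply: IJ.
Qed.

(** On a right fixed [v], [e \o_(n) v] is congruent to [e \o_(n) (v \o_(1) e)],
    which [cprodAr] expands into right multiples of [e]. *)
Lemma right_fixed_l n v : right_fixed v -> right_fixed (e \o_(n) v).
Proof.
move=> [Jv vfix]; apply: (@right_fixed_eqmod _ (e \o_(n) (v \o_(1) e))).
  by rewrite vfix.
rewrite cprodAr; apply: (subspace_sum right_fixed_subspace) => t.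
by apply: (subspaceMn right_fixed_subspace); apply/right_fixed_r/Jl.
Qed.

Let r1 := defect e 1.
Let J_r1 : J r1. Proof. exact: e_approx. Qed.
Let sR := right_fixed_subspace.
Let J_e1 v : J v -> J (e \o_(1) v). Proof. exact: Jl. Qed.
Let R_e1 v : right_fixed v -> right_fixed (e \o_(1) v).
Proof. exact: right_fixed_l. Qed.

Lemma approxD m : J m -> approx J (e + m).
Proof.
move=> Jm n n_gt0; rewrite defectD.
apply: (subspaceD sJ); last exact: Jr.
apply: (subspaceD sJ); first exact: e_approx.
apply: (subspaceB sJ); last exact: subspaceMn.
by apply: (subspaceD sJ); [apply: Jl | apply: Jr].
Qed.

Lemma defect1D m : J m ->
  defect (e + m) 1 ≡ r1 + euler_shift e 1 m + m \o_(1) e.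
Proof.
move=> Jm; rewrite defectD [X in eqmod I (_ + X) _]eqmod0 ?addr0; last first.
  exact: JJ.
by rewrite /euler_shift addrAC !addrA.
Qed.

(** Modulo right fixed elements the cocycle identities give
    [e_1 r_1 = e_0 r_2] and [r_2 = e_2 r_1 - e_0 r_3], hence
    [e_1 r_1 = e_1 (e_1 - 1) r_1 - e_0 e_0 r_3].  As [e_0 e_0] only reaches
    weights at least 2, the component of weight 1 on both sides yields that
    of [r_1] to be 0; [u] below is a multiple of that component. *)
Lemma fix_defect1 : exists2 m, J m & right_fixed (defect (e + m) 1).
Proof.
have [K1 HK1] := euler_prod_nil J_r1.
have J_r3 : J (defect e 3) by apply: e_approx.
have [K3 HK3] := euler_prod_nil J_r3.
(* Among the possible weights [0 .. k+1], [g] lists all but 1. *)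
pose k := maxn K1 K3; pose g := 0%N :: iota 2 k; pose u := euler_prod e g r1.
have u_e1 : e \o_(1) u ≡ u.
  rewrite /eqmod -[u in X in I X]mulr1n -/(euler_shift e 1 u) -euler_prod_shift.
  have := HK1 k.+2; rewrite /eqmod subr0 /= euler_shiftC; apply.
  exact: leq_trans (leq_maxl K1 K3) (leq_addl 2 k).
(* [e_0 e_0] shifts the roots [0 .. k-1] that annihilate [r_3] to
   [2 .. k+1], all of which are in [g]. *)
have G33 : euler_prod e g (e \o_(0) (e \o_(0) defect e 3)) ≡ 0.
  rewrite /= euler_prod_shift 2!iota_succ.
  rewrite (euler_prod_e0 _ (Jl 0 e J_r3)) (euler_prod_e0 _ J_r3).
  by rewrite HK3 ?leq_maxr // !cprod0r raddf0.
pose w := e \o_(1) r1 + e \o_(0) (e \o_(0) defect e 3)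
          - (e \o_(1) (e \o_(1) r1) - e \o_(1) r1).
have Rw : right_fixed w.
  pose z := defect e 2 \o_(1) e + (r1 \o_(2) e) *+ 2.
  have Rz : right_fixed z.
    apply: (subspaceD sR); first exact/right_fixed_r/e_approx.
    exact/(subspaceMn sR)/right_fixed_r.
  have r2E : defect e 2 = e \o_(2) r1 - e \o_(0) defect e 3 - z.
    have := defect_cocycle e 0; rewrite big_ord1 subn0 addn0 bin0 mulr1n -/r1.
    rewrite mulrnDl [defect e 2 *+ 2]mulr2n => /eqP.
    rewrite [X in _ == X](_ : _ =
        defect e 2 + (z + defect e 2 + e \o_(0) defect e 3)).
      rewrite addrC (inj_eq (addrI _)) => /eqP->.
      by rewrite addrK addrAC subrr add0r.
    by rewrite /z; move: (_ *+ 2) => P; rewrite !addrA [LHS](ACl (2*1*4*3*5)).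
  apply: (@right_fixed_eqmod _ (r1 \o_(1) e - e \o_(0) z)).
    rewrite /w euler_relation // addrK defect_cocycle1 r2E !cprodBr -/r1 !addrA.
    by rewrite [X in eqmod I X _](ACl (1*4*(2*6)*(3*5))) /= addrN addNr !addr0.
  apply: (subspaceB sR); first exact: right_fixed_r.
  exact: right_fixed_l.
have Ru : right_fixed u.
  apply: right_fixed_eqmod (euler_prod_stable sR R_e1 g Rw).
  rewrite /w !(euler_prodB, euler_prodD) G33 !euler_prod_e1 -/u !u_e1.
  by rewrite subrr subr0 addr0.
have [|x [w' [nz_x Jw' uE]]] :=
  euler_prod_remainder sJ J_e1 charF0 (s := g) (d := 1) _ J_r1.
  by rewrite inE mem_iota.
exists (x^-1%:P *: w'); first exact: subspaceZ.
apply: (@right_fixed_eqmod _ _ (defect1D _)); first exact: subspaceZ.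
apply: (subspaceD sR); last by apply: right_fixed_r; apply: subspaceZ.
have -> : r1 + euler_shift e 1 (x^-1%:P *: w') = x^-1%:P *: u.
  rewrite /u uE scalerDr scalerA -polyCM mulVf // polyC1 scale1r.
  by rewrite euler_shiftZ.
exact: subspaceZ.
Qed.

(** Now [(e_1 - 1) r_1 = e_0 r_2] has only weights at least 1, so [r_1] has no
    component of weight 0 and is [- e_1 m] for some [m].  This [m] can be
    taken right fixed, and then adding it to [e] changes [r_1] by
    [(e_1 - 1 + T) m = e_1 m]. *)
Lemma kill_defect1 : right_fixed r1 -> exists2 m, J m & I (defect (e + m) 1).
Proof.
move=> Rr1; have J_r2 : J (defect e 2) by apply: e_approx.
have [K1 HK1] := euler_prod_nil J_r1; have [K2 HK2] := euler_prod_nil J_r2.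
pose k := maxn K1 K2; pose u := euler_prod e (iota 1 k) r1.
(* [u] is proportional to the component of weight 0, so [e_1] kills it; but
   [e_1 - 1] kills it too. *)
have u_e1 : e \o_(1) u ≡ 0.
  have := HK1 k.+1; rewrite /= euler_prod_shift -/u /euler_shift subr0.
  by apply; apply: leq_trans (leq_maxl K1 K2) (leqnSn k).
have u0 : u ≡ 0.
  have : euler_prod e (iota 1 k) (e \o_(0) defect e 2) ≡ 0.
    rewrite iota_succ (euler_prod_e0 _ J_r2) HK2 ?leq_maxr //.
    by rewrite cprod0r.
  have -> : e \o_(0) defect e 2 = e \o_(1) r1 - r1 \o_(1) e.
    by rewrite defect_cocycle1 addrC addKr.
  have [_ r1fix] := Rr1; rewrite r1fix raddfB /= euler_prod_e1 -/u u_e1 sub0r.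
  by move=> h; rewrite -[u]opprK h oppr0.
have [|x [w [nz_x Rw uE]]] :=
  euler_prod_remainder sR R_e1 charF0 (s := iota 1 k) (d := 0) _ Rr1.
  by rewrite mem_iota.
have Rm : right_fixed (x^-1%:P *: w) by apply: subspaceZ.
have [Jm mfix] := Rm; exists (x^-1%:P *: w) => //.
suff : defect (e + x^-1%:P *: w) 1 ≡ 0 by rewrite /eqmod subr0.
rewrite defect1D // mfix /euler_shift mulr1n addrA subrK.
have -> : r1 + e \o_(1) (x^-1%:P *: w) = x^-1%:P *: u.
  rewrite /u uE scalerDr scalerA -polyCM mulVf // polyC1 scale1r.
  by rewrite -euler_shiftZ /euler_shift mulr0n subr0.
rewrite /eqmod subr0; apply: (subspaceZ sI).
by move: u0; rewrite /eqmod subr0.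
Qed.

(** Modulo right fixed elements the cocycle identity is
    [(a - 1) r_a = - e_0 r_(a+1)]; by locality [r_a = 0] for large [a], so all
    [r_a] are right fixed.  Then [r_a \o_(1) e] restores the missing
    [r_a], the other right multiples vanish, and
    [a r_a = - e_0 r_(a+1)] gives [r_a = 0] by a second downward induction. *)
Lemma defects_vanish : I r1 -> approx I e.
Proof.
move=> I_r1.
have [N HN] := cprod_local e e.
have downward (Q : B -> Prop) : Q 0 ->
    (forall k, (forall j, (k < j)%N -> Q (defect e j.+2)) -> Q (defect e k.+2)) ->
  forall k, Q (defect e k.+2).
  move=> Q0 QS k; have [n] := ubnP (N - k)%N; elim: n k => // n IHn k hk.
  have [le_Nk|lt_kN] := leqP N k.
    by rewrite !defect.unlock HN ?mulr0n ?subr0 // ltnW // ltnW.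
  by apply: QS => j hj; apply: IHn; apply: leq_trans (ltn_sub2l lt_kN hj) hk.
have fixedI a : I a -> right_fixed a.
  move=> Ia; apply: (@right_fixed_eqmod a 0); last exact: subspace0.
  by rewrite /eqmod subr0.
have fixed k : right_fixed (defect e k.+2).
  apply: (downward right_fixed) => {k} [|k IHk]; first exact: subspace0.
  apply: (subspace_divn sR charF0 (n := k)); rewrite defect_mulrn.
  apply: (subspaceB sR); first exact/fixedI/Il.
  apply: (subspaceD sR); last exact/right_fixed_l/IHk.
  apply: (subspaceD sR); last exact/(subspaceMn sR)/right_fixed_r.
  apply: (subspace_sum sR) => t; apply: (subspaceMn sR); apply: right_fixed_r.
  by apply: e_approx; rewrite subn_gt0; apply: leq_trans (ltn_ord t) (leqnSn _).
case=> [//|[|n]] _ //; apply: (downward I) => {n} [|k IHk]; first exact: subspace0.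
apply: (subspace_divn sI charF0 (n := k.+1)); rewrite mulrSr defect_mulrn.
rewrite big_ord_recl bin0 mulr1n subn0 addn0.
suff zero : e \o_(k.+2) defect e 1 - (defect e k.+2 \o_(1) e
    + \sum_(i < k) (defect e (k.+2 - lift ord0 i) \o_(1 + lift ord0 i) e)
                     *+ 'C(k.+2, lift ord0 i)
    + (defect e 1 \o_(k.+2) e) *+ k.+2 + e \o_(0) defect e k.+3)
    + defect e k.+2 ≡ 0 by move: zero; rewrite /eqmod subr0.
have [_ ->] := fixed k.
have null a : I a -> a ≡ 0 by move=> Ia; rewrite /eqmod subr0.
rewrite (null _ (Il k.+2 e I_r1)) (null _ (Il 0 e (IHk _ (ltnSn k)))).
rewrite [X in eqmod I (_ - (_ + X + _) + _) _]null; last first.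
  by apply: (subspaceMn sI); case: idI => _ _; apply.
rewrite !addr0 sub0r [X in eqmod I (- (_ + X) + _) _]null.
  by rewrite addr0 addNr.
apply: (subspace_sum sI) => t; apply: (subspaceMn sI).
rewrite -[X in I X]subr0; apply: right_fixed_kill => //.
by rewrite lift0 subSS subSn ?(ltnW (ltn_ord t)) // -subnSK.
Qed.

End FixedLift.

(** Being right fixed does not depend on the lift: replacing [e] by [e + m]
    changes [v \o_(1) e] by an element of [J \o J]. *)
Lemma improve_approx e : approx J e -> exists2 m, J m & approx I (e + m).
Proof.
move=> e_approx; have [m Jm [J_r1 r1fix]] := fix_defect1 e_approx.
have e_approx' := approxD e_approx Jm.
have Rr1 : right_fixed (e + m) (defect (e + m) 1).
  split=> //; rewrite cprodDr r1fix [X in eqmod I (_ + X) _]eqmod0 ?addr0 //.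
  exact: JJ.
have [m' Jm' I_r1] := kill_defect1 e_approx' Rr1.
exists (m + m'); first exact: (subspaceD sJ).
by rewrite addrA; apply: defects_vanish I_r1; apply: approxD.
Qed.

End LiftStep.

(** * The tower of ideals below a nilpotent ideal *)

Section IdealPowers.
Variables (F : fieldType) (B : assocConformalType F).
Implicit Types (P Q J N : B -> Prop) (a b : B).

Inductive additive_span P : B -> Prop :=
| span_zero : additive_span P 0
| span_gen a : P a -> additive_span P a
| span_add a b : additive_span P a -> additive_span P b ->
    additive_span P (a + b).

Lemma span_cprod P Q n a b :
    (forall u v, P u -> P v -> Q (u \o_(n) v)) ->
  additive_span P a -> additive_span P b -> additive_span Q (a \o_(n) b).
Proof.
move=> PQ; elim=> [|u Pu|u v _ IHu _ IHv] Sb.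
- by rewrite cprod0l; apply: span_zero.
- elim: Sb => [|v Pv|v w _ IHv _ IHw].
  + by rewrite cprod0r; apply: span_zero.
  + exact/span_gen/PQ.
  + by rewrite cprodDr; apply: span_add.
by rewrite cprodDl; apply: span_add; [apply: IHu | apply: IHv].
Qed.

Definition ideal_square J :=
  additive_span (fun z => exists n a b, [/\ J a, J b & z = a \o_(n) b]).

Lemma cprod_square J n a b : J a -> J b -> ideal_square J (a \o_(n) b).
Proof. by move=> Ja Jb; apply: span_gen; exists n, a, b. Qed.

Lemma ideal_square_sub J a : ideal J -> ideal_square J a -> J a.
Proof.
case=> -[J0 JD JZ] Jl Jr; elim=> [//|_ [n [u [v [Ju Jv ->]]]]|u v _ Ju _ Jv].
  exact: Jl.
exact: JD.
Qed.

Lemma ideal_square_ideal J : ideal J -> ideal (ideal_square J).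
Proof.
case=> sJ Jl Jr.
have sub : subspace (ideal_square J).
  split=> [|a b Sa Sb|x a]; [exact: span_zero | exact: span_add |].
  elim=> [|_ [n [u [v [Ju Jv ->]]]]|u v _ Su _ Sv].
  - by rewrite scaler0; apply: span_zero.
  - by rewrite -cprodZl; apply: cprod_square => //; apply: subspaceZ.
  - by rewrite scalerDr; apply: span_add.
split=> // n a b.
  elim=> [|_ [m [u [v [Ju Jv ->]]]]|u v _ Su _ Sv].
  - by rewrite cprod0r; apply: span_zero.
  - rewrite cprodAr; apply: (subspace_sum sub) => t; apply: (subspaceMn sub).
    by apply: cprod_square => //; apply: Jl.
  - by rewrite cprodDr; apply: span_add.
elim=> [|_ [m [u [v [Ju Jv ->]]]]|u v _ Su _ Sv].
- by rewrite cprod0l; apply: span_zero.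
- rewrite cprodA; apply: (subspace_sum sub) => s.
  have -> : (-1) ^+ s = ((-1) ^+ s)%:P :> {poly F}.
    by rewrite rmorphXn /= polyCN polyC1.
  apply: (subspaceZ sub); apply: (subspaceMn sub).
  by apply: cprod_square => //; apply: Jr.
- by rewrite cprodDl; apply: span_add.
Qed.

Definition ideal_tower N k := iter k ideal_square N.

Lemma ideal_tower_ideal N k : ideal N -> ideal (ideal_tower N k).
Proof. by move=> idN; elim: k => //= k; apply: ideal_square_ideal. Qed.

Lemma ideal_tower_sub N k a : ideal N -> ideal_tower N k a -> N a.
Proof.
move=> idN; elim: k => //= k IHk /ideal_square_sub Sa; apply/IHk/Sa.
exact: ideal_tower_ideal.
Qed.

Lemma ideal_tower_products N k a :
  ideal_tower N k a -> additive_span (product_of N (2 ^ k)) a.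
Proof.
elim: k a => [|k IHk] a /=; first by move=> Na; apply/span_gen/product_one.
elim=> [|_ [n [u [v [Ju Jv ->]]]]|u v _ Su _ Sv].
- exact: span_zero.
- apply: span_cprod (IHk _ Ju) (IHk _ Jv) => u' v' Pu Pv.
  by rewrite expnS mul2n -addnn; apply: product_mul.
- exact: span_add.
Qed.

(** Two neighbouring factors of a bracketed product can be merged into one
    element of the ideal [N].  This allows to compare products of
    [2 ^ k] factors, which span the tower, with those of exactly [r] factors,
    which vanish. *)
Lemma product_of_pred N s a : ideal N -> product_of N s a ->
  (s = 1%N /\ N a) \/ ((1 < s)%N /\ product_of N s.-1 a).
Proof.
case=> _ Nl _; elim=> [u Nu|r t n u v Pu IHu Pv IHv]; first by left.
right; case: IHu => [[-> Nu]|[r_gt1 Pu']].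
  case: IHv => [[-> Nv]|[t_gt1 Pv']]; first by split=> //; apply/product_one/Nl.
  split; first by rewrite ltnS ltnW.
  have -> : (1 + t).-1 = (1 + t.-1)%N by case: (t) t_gt1.
  by apply: product_mul => //; apply: product_one.
split; first by rewrite ltn_addr.
have -> : (r + t).-1 = (r.-1 + t)%N by case: (r) r_gt1.
exact: product_mul.
Qed.

Lemma nilpotent_tower N :
  ideal N -> conformal_nilpotent N ->
  exists k, forall a, ideal_tower N k a -> a = 0.
Proof.
move=> idN [r r_gt0 nilN]; exists r => a /ideal_tower_products.
have zero s z : (r <= s)%N -> product_of N s z -> z = 0.
  elim: s => [|s IHs]; first by rewrite leqNgt r_gt0.
  rewrite leq_eqVlt => /predU1P[<-|lt_rs]; first exact: nilN.
  case/(product_of_pred idN) => [[s0 _]|[_ /=]]; last exact: IHs.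
  by case: s0 lt_rs => ->; rewrite ltnNge r_gt0.
elim=> [//|z|u v _ -> _ ->]; last by rewrite addr0.
by apply: zero; rewrite ltnW // ltn_expl.
Qed.

End IdealPowers.

(** * The homomorphism defined by an exact lift *)

Section Representation.
Variables (F : fieldType) (B : assocConformalType F) (e : B).
Hypothesis e_exact : approx (eq^~ 0) e.

(** [epow k] corresponds to [x^(k+1)]. *)
Definition epow k : B := iter k (cprod 0 e) e.

Lemma cprod_e_e n : (0 < n)%N -> e \o_(n) e = e *+ (n == 1).
Proof. by move=> n_gt0; rewrite cprod_self e_exact ?addr0. Qed.

(** Induction on [k]: by [cprodAr],
    [e_n (e_0 v) = e_0 (e_n v) + n e_(n-1) v], the Leibniz rule for
    [x d^n (x v)]. *)
Lemma cprod_e_pow n k : e \o_(n) epow k = epow (k.+1 - n) *+ k.+1 ^_ n.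
Proof.
elim: k n => [|k IHk] [|n] //; first by rewrite cprod_e_e //; case: n => [|[]].
rewrite /= cprodAr 2!big_ord_recr /= binn mulr1n subnn binSn subSnn.
rewrite cprod0A !add0n cprod_e_e // mulr1n big1 ?add0r => [|t _]; last first.
  have lt_tn := ltn_ord t; rewrite cprod_e_e ?subn_gt0 ?(ltn_trans lt_tn) //.
  by rewrite gtn_eqF ?mulr0n ?cprod0l ?mul0rn // ltn_subRL addn1 ltnS.
rewrite !IHk cprodMnr -mulrnA (subSS n k.+1) (ffactSS k.+1) (ffactnSr k.+1).
have [le_nk|lt_kn] := leqP n k.
  have -> : e \o_(0) epow (k.+1 - n.+1) = epow (k.+1 - n).
    by rewrite subSS subSn.
  rewrite -mulrnDr -mulnDr mulnC; congr (_ *+ (_ * _)).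
  by rewrite addSn subnKC // ltnW.
have /eqP -> : (k.+1 - n == 0)%N by rewrite subn_eq0.
rewrite muln0 mulr0n addr0.
have [->|neq] := eqVneq n k.+1; first by rewrite mulnC.
by rewrite ffact_small ?mul0n ?muln0 // ltn_neqAle eq_sym neq.
Qed.

Lemma cprod_pow n k l :
  epow k \o_(n) epow l = epow (k + l.+1 - n) *+ l.+1 ^_ n.
Proof.
elim: k => [|k IHk]; first exact: cprod_e_pow.
rewrite /= cprod0A IHk cprodMnr; have [le_nl|lt_ln] := leqP n l.+1.
  by rewrite addSn subSn // (leq_trans le_nl) ?leq_addl.
by rewrite ffact_small.
Qed.

(** At [i = 0] the predecessor truncates, but the coefficient of [x^0] is 0. *)
Definition pow_map (a : Cend1x F) : B :=
  \sum_(i < size (val a)) (val a)`_i *: epow i.-1.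

Lemma pow_mapE n (a : Cend1x F) : (size (val a) <= n)%N ->
  pow_map a = \sum_(i < n) (val a)`_i *: epow i.-1.
Proof.
move=> le_an; rewrite /pow_map.
rewrite (big_ord_widen n (fun i => (val a)`_i *: epow i.-1)) //.
rewrite big_mkcond /=; apply: eq_bigr => i _; case: ltnP => // le_ai.
by rewrite nth_default ?scale0r.
Qed.

Lemma pow_map_linear : linear pow_map.
Proof.
move=> p a b; pose n :=
  maxn (size (val (p *: a + b))) (maxn (size (val a)) (size (val b))).
rewrite !(@pow_mapE n) ?leq_max ?leqnn ?orbT // scaler_sumr -big_split.
by apply: eq_bigr => i _; rewrite /= coefD coefZ scalerDl scalerA.
Qed.

HB.instance Definition _ :=
  GRing.isLinear.Build {poly F} (Cend1x F) B *:%R pow_map pow_map_linear.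

Lemma pow_map_pow k : pow_map (cend1x_pow F k) = epow k.
Proof.
rewrite (@pow_mapE k.+2) /= ?size_polyXn // big_ord_recr big1 /= => [|i _].
  by rewrite coefXn eqxx scale1r add0r.
by rewrite coefXn ltn_eqF ?scale0r.
Qed.

(** The powers of [x] generate the [F[D]]-module. *)
Lemma cend1x_ind (P : Cend1x F -> Prop) :
  (forall a b, P a -> P b -> P (a + b)) -> (forall a, P a -> P ('X *: a)) ->
  (forall (x : F) a, P a -> P (x%:P *: a)) ->
  (forall k, P (cend1x_pow F k)) -> forall a, P a.
Proof.
move=> PD PX PZ Pp a.
have P0 : P 0 by rewrite -(scale0r (cend1x_pow F 0)); apply: (PZ 0).
have -> : a = \sum_(i < size (val a)) (val a)`_i *: cend1x_pow F i.-1.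
  apply: val_inj; rewrite raddf_sum /= -[LHS]coefK poly_def.
  apply: eq_bigr => -[[|i] lt_i] _ //=.
  by have /xmultipleP -> := valP a; rewrite !scale0r.
elim/big_ind: _ => // i _; elim/poly_ind: (_`_i) => [|q c IHq].
  by rewrite scale0r.
by rewrite scalerDl mulrC -scalerA; apply: PD; [apply: PX | apply: PZ].
Qed.

Lemma pow_map_hom : conformal_hom pow_map.
Proof.
move=> n a b; elim/cend1x_ind: a n b => [a a' IH IH'|a IH|x a IH|k] n b.
- by rewrite cprodDl !raddfD /= IH IH' cprodDl.
- by rewrite cprod_Dl raddfN raddfMn /= IH linearZ /= cprod_Dl.
- by rewrite cprodZl !linearZ /= IH cprodZl.
elim/cend1x_ind: b n => [b b' IH IH'|b IH|x b IH|l] n.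
- by rewrite cprodDr !raddfD /= IH IH' cprodDr.
- by rewrite cprod_Dr raddfD raddfMn /= !linearZ /= !IH cprod_Dr.
- by rewrite cprodZr !linearZ /= IH cprodZr.
have -> : cend1x_pow F k \o_(n) cend1x_pow F l
    = cend1x_pow F (k + l.+1 - n) *+ l.+1 ^_ n.
  apply: val_inj; rewrite raddfMn /= cend_prodXn mulnC bin_ffact.
  have [le_nl|lt_ln] := leqP n l.+1; last by rewrite ffact_small.
  by rewrite addSn subSn // (leq_trans le_nl) ?leq_addl.
by rewrite raddfMn /= !pow_map_pow cprod_pow.
Qed.

End Representation.

Theorem mainTheorem2 (F : fieldType) (charF0 : [pchar F] =i pred0)
  (B : assocConformalType F) (sigma : {linear B -> Cend1x F})
  (sigma_hom : conformal_hom sigma)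
  (sigma_surj : forall c : Cend1x F, exists b : B, sigma b = c)
  (ker_nilp : conformal_nilpotent (kernel sigma)) :
  exists C' : B -> Prop,
    [/\ conformal_subalgebra C',
        isomorphic_onto (Cend1x F) C'
      & direct_sum_decomposition C' (kernel sigma)].
Proof.
pose N := kernel sigma; pose x := cend1x_pow F 0.
have idN : ideal N.
  split; first split; rewrite /N /kernel.
  - by rewrite raddf0.
  - by move=> a b a0 b0; rewrite raddfD /= a0 b0 addr0.
  - by move=> c a a0; rewrite linearZ /= a0 scaler0.
  - by move=> n a b b0; rewrite sigma_hom b0 cprod0r.
  - by move=> n a b a0; rewrite sigma_hom a0 cprod0l.
have [k nilN] := nilpotent_tower idN ker_nilp.
have [e sigma_e e_exact] : exists2 e, sigma e = x & approx (eq^~ 0) e.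
  have [e sigma_e e_approx] : exists2 e, sigma e = x & approx (ideal_tower N k) e.
    elim: (k) => [|j [e sigma_e e_approx]].
      have [e sigma_e] := sigma_surj x; exists e => // n n_gt0.
      rewrite /= /N /kernel defect.unlock raddfB raddfMn /= sigma_hom sigma_e.
      apply: val_inj; rewrite raddfB raddfMn /= cend_prodXn.
      case: n n_gt0 => [|[|n]] // _; first by rewrite subrr.
      by rewrite bin_small // muln0 mulr0n subr0.
    have idJ := ideal_tower_ideal j idN.
    have [m Jm em_approx] := improve_approx charF0 idJ
      (ideal_square_ideal idJ) (fun a => ideal_square_sub idJ)
      (@cprod_square _ _ _) e_approx.
    exists (e + m) => //; rewrite raddfD /= sigma_e.
    by rewrite (ideal_tower_sub idN Jm) addr0.
  by exists e => // n /e_approx /nilN.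
pose f : {linear Cend1x F -> B} := pow_map e.
have f_hom : conformal_hom f := pow_map_hom e_exact.
have fK a : sigma (f a) = a.
  elim/cend1x_ind: a => [a b IHa IHb|a IH|c a IH|j].
  - by rewrite !raddfD /= IHa IHb.
  - by rewrite !linearZ /= IH.
  - by rewrite !linearZ /= IH.
  rewrite /= pow_map_pow; elim: j => [//|j IHj].
  rewrite /= sigma_hom IHj sigma_e; apply: val_inj.
  by rewrite /= cend_prodXn bin0 muln1 mulr1n.
exists (fun b => exists c, f c = b); split.
- split=> [|_ _ [a <-] [b <-]|p _ [a <-]|n _ _ [a <-] [b <-]].
  + by exists 0; rewrite raddf0.
  + by exists (a + b); rewrite raddfD.
  + by exists (p *: a); rewrite linearZ.
  + by exists (a \o_(n) b); rewrite f_hom.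
- by exists f; split=> //; apply: can_inj fK.
split=> [b|_ [a <-]]; last by rewrite /kernel fK => ->; rewrite raddf0.
exists (f (sigma b)), (b - f (sigma b)); split; first by exists (sigma b).
  by rewrite /kernel raddfB /= fK subrr.
by rewrite addrC subrK.
Qed.
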